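(* Let $M$ be a (nonempty) finitely triangulable topological space and let $f=(f_1,f_2),\,g=(g_1,g_2):M\to\mathbb{R}^2$ be two continuous functions. Then $$\|f-g\|_\infty=\sup_{(a,b)\in\,]0,1[\,\times\mathbb{R}}\left\|f^*_{(a,b)}-g^*_{(a,b)}\right\|_\infty=\sup_{b\in\mathbb{R}}\left\|f^*_{(1/2,b)}-g^*_{(1/2,b)}\right\|_\infty.$$
   Context: For a continuous $f=(f_1,f_2):M\to\mathbb{R}^2$ and $(a,b)\in\,]0,1[\,\times\mathbb{R}$, $f^*_{(a,b)}:M\to\mathbb{R}$ is defined by $f^*_{(a,b)}(x)=\min\{a,1-a\}\cdot\max\left\{\frac{f_1(x)-b}{a},\frac{f_2(x)+b}{1-a}\right\}$. For real-valued functions $\|\cdot\|_\infty$ is the sup-norm; for $\mathbb{R}^2$-valued functions $\|f-g\|_\infty=\max_{x\in M}\max\{|f_1(x)-g_1(x)|,|f_2(x)-g_2(x)|\}$. *)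

(* Defs.v *)
From mathcomp Require Import all_boot all_order all_algebra.
From mathcomp Require Import all_classical all_reals all_analysis.
Set Implicit Arguments.
Unset Strict Implicit.
Unset Printing Implicit Defensive.
Import Order.TTheory GRing.Theory Num.Theory.
Import numFieldNormedType.Exports.
Local Open Scope classical_set_scope.
Local Open Scope ring_scope.

Definition simplicial_complex (n : nat) (K : {set {set 'I_n}}) : Prop :=
  forall s : {set 'I_n}, s \in K ->
    (0 < #|s|)%N /\
    (forall t : {set 'I_n}, t \subset s -> (0 < #|t|)%N -> t \in K).

(* Barycentric coordinates: the vertex i is sent to the i-th basis vector, and
   a point is a convex combination of vertices whose support is a simplex. *)
Definition realization (R : realType) (n : nat) (K : {set {set 'I_n}}) :
    set 'rV[R]_n :=
  [set x | [/\ forall i, 0 <= x ord0 i, \sum_i x ord0 i = 1 &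
               finset (fun i => x ord0 i != 0) \in K]].

Definition homeomorphic (X Y : topologicalType) : Prop :=
  exists (h : X -> Y) (k : Y -> X),
    [/\ continuous h, continuous k, cancel h k & cancel k h].

(* [set_type A] carries the subspace topology of A. *)
Definition finitely_triangulable (R : realType) (M : topologicalType) : Prop :=
  exists (n : nat) (K : {set {set 'I_n}}),
    simplicial_complex K /\ homeomorphic M (set_type (@realization R n K)).

(* The supremum is taken in the extended reals, so that it is meaningful without
   a boundedness hypothesis. On R * R the library norm is the maximum of the
   absolute values of the two coordinates. *)
Definition supnorm (R : realType) (M : Type) (V : normedZmodType R)
    (u : M -> V) : \bar R :=
  ereal_sup [set `|u x|%:E | x in [set: M]].

Definition fstar (R : realType) (M : Type) (f : M -> R * R) (ab : R * R)
    (x : M) : R :=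
  let: (a, b) := ab in
  Num.min a (1 - a) *
  Num.max (((f x).1 - b) / a) (((f x).2 + b) / (1 - a)).

(* Main.v *)
(* For every (a, b) the map f |-> f^*_(a, b) is pointwise 1-Lipschitz, because max
   is and min(a, 1 - a) / a and min(a, 1 - a) / (1 - a) are at most 1. Conversely
   f^*_(1/2, b) = max(f_1 - b, f_2 + b), so at a given point a b of large modulus
   recovers either coordinate of f - g. *)
Require Import Defs.
From mathcomp Require Import all_boot all_order all_algebra.
From mathcomp Require Import all_classical all_reals all_analysis.
From mathcomp Require Import ring lra.
Import Order.TTheory GRing.Theory Num.Theory.
Import numFieldNormedType.Exports.
Local Open Scope classical_set_scope.
Local Open Scope ring_scope.

(** A filter on the subtype is pushed forward along [set_val] to a filter on [T] containing [A]. A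
    cluster point of the image filter in [A] lifts back, because neighbourhoods in the subtype are
    traces of neighbourhoods in [T]. *)
Lemma compact_set_type (T : topologicalType) (A : set T) :
  compact A -> compact [set: set_type A].
Proof.
move=> cA F PF _.
have FA : F (set_val @^-1` A) by apply: filterE => x; exact: set_valP.
have [p [Ap clp]] := cA (set_val @ F) _ FA.
exists (exist _ p (mem_set Ap)); split=> // B C FB [D [[U oU UD] Dp] DC].
have FB' : F (set_val @^-1` (set_val @` B)) by apply: filterS FB => x Bx; exists x.
have Up : nbhs p U.
  by apply: open_nbhs_nbhs; split => //; move: Dp; rewrite -UD.
have [_ [[x Bx <-] Ux]] := clp _ _ FB' Up.
by exists x; split => //; apply: DC; rewrite -UD.
Qed.

(* The down-closure of K makes "the support is a simplex" a closed condition: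
   it becomes "the support is contained in a simplex". *)
Lemma realization_simplexE (R : realType) (n : nat) (K : {set {set 'I_n}}) :
  simplicial_complex K ->
  realization K =
  [set x : 'rV[R]_n | forall i, `[0, 1]%classic (x ord0 i)] `&`
  ([set x | \sum_i x ord0 i = 1] `&`
   \bigcup_(s in [set` K]) \bigcap_(i in [set` ~: s]) [set x | x ord0 i = 0]).
Proof.
move=> scK; apply/seteqP; split => [x [x0 x1 xK]|x [x01 [x1 [s /= sK xs]]]].
  split; last split => //.
    move=> i /=; rewrite in_itv /= x0 /= -x1 (bigD1 i) //= lerDl.
    exact: sumr_ge0.
  exists (finset (fun i => x ord0 i != 0)) => // i /=.
  by rewrite !inE negbK => /eqP.
have x0 i : 0 <= x ord0 i by move: (x01 i); rewrite /= in_itv /= => /andP[].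
split => //; apply: (proj2 (scK _ sK)).
  apply/fintype.subsetP => i; rewrite inE; apply: contraR => si.
  by apply/eqP/xs; rewrite /= inE.
(* Only nonempty faces belong to [K]; an empty support would make the coordinate sum 0 instead of
   1. *)
rewrite card_gt0; apply/set0Pn.
have [[i xi]|no] := pselect (exists i, x ord0 i != 0).
  by exists i; rewrite inE.
have /eqP := x1; rewrite big1 ?(eq_sym 0) ?oner_eq0 // => i _.
by apply: contrapT => /eqP xi; apply: no; exists i.
Qed.

(** The realization is a closed part of the compact cube: the sum condition is closed, and the
    support condition is a union of closed sets over the finitely many simplices. *)
Lemma realization_compact (R : realType) (n : nat) (K : {set {set 'I_n}}) :
  simplicial_complex K -> compact (@realization R n K).
Proof.
move=> /realization_simplexE ->; apply: compact_closedI.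
  apply: (@rV_compact R n (fun=> `[0, 1]%classic)) => i; exact: segment_compact.
have coord i : continuous (fun x : 'rV[R]_n => x ord0 i).
  exact: coord_continuous.
apply: closedI.
  apply: (@preimage_closed _ _ (fun x : 'rV[R]_n => \sum_i x ord0 i) [set 1]);
    last exact: closed_eq.
  by move=> x _; apply: continuous_big => //; exact: add_continuous.
apply: closed_bigcup => // s _; apply: closed_bigI => i _.
apply: (@preimage_closed _ _ (fun x : 'rV[R]_n => x ord0 i) [set 0]);
  last exact: closed_eq.
by move=> x _; exact: coord.
Qed.

Lemma finitely_triangulable_compact (R : realType) (M : topologicalType) :
  finitely_triangulable R M -> compact [set: M].
Proof.
move=> [n [K [scK [h [k [_ ck hK _]]]]]].
have -> : [set: M] = k @` setT.
  by apply/seteqP; split => // x _; exists (h x); rewrite ?hK.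
apply: continuous_compact; first exact: continuous_subspaceT.
exact/compact_set_type/realization_compact.
Qed.

(** This identifies the supremum in [supnorm] with the maximum by which the norm of an
    [R * R]-valued function is defined; in particular it is finite. *)
Lemma compact_supnorm_attained (R : realType) (M : topologicalType)
    (V : normedModType R) (u : M -> V) :
  [set: M] !=set0 -> compact [set: M] -> continuous u ->
  exists x, supnorm u = `|u x|%:E.
Proof.
move=> M0 cM cu.
have [|x _ ux] := @compact_EVT_max _ _ (fun x => `|u x|) _ M0 cM.
  by apply: continuous_subspaceT => x; apply: cvg_norm; exact: cu.
exists x; apply/eqP; rewrite eq_le; apply/andP; split.
  by apply: ge_ereal_sup => _ [y _ <-]; rewrite lee_fin ux // inE.
by apply: ereal_sup_ubound; exists x.
Qed.

Lemma dist_max_le (R : realDomainType) (a b c d e : R) :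
  `|a - c| <= e -> `|b - d| <= e -> `|Num.max a b - Num.max c d| <= e.
Proof.
rewrite !ler_norml => /andP[? ?] /andP[? ?].
by case: (leP a b) => ?; case: (leP c d) => ?; lra.
Qed.

Lemma fstar_dist_le (R : realType) (M : Type) (f g : M -> R * R) (a b : R)
    (x : M) :
  0 < a < 1 -> `|fstar f (a, b) x - fstar g (a, b) x| <= `|f x - g x|.
Proof.
move=> /andP[a0 a1]; have a1' : 0 < 1 - a by rewrite subr_gt0.
have m0 : 0 < Num.min a (1 - a) by rewrite lt_min a0.
(* Moving the factor [Num.min a (1 - a)] to the right leaves a difference of two maxima, which is
   bounded argument by argument. Each argument is divided by [c = a] or [c = 1 - a], and both are at
   least that minimum. *)
rewrite /fstar -mulrBr normrM gtr0_norm // mulrC -ler_pdivlMr //.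
have dist_div (c u v : R) : 0 < c -> Num.min a (1 - a) <= c ->
    `|u - v| <= `|f x - g x| ->
    `|u / c - v / c| <= `|f x - g x| / Num.min a (1 - a).
  move=> c0 mc uv; rewrite -mulrBl normrM (gtr0_norm (x := c^-1)) ?invr_gt0 //.
  by rewrite ler_pM ?invr_ge0 ?(ltW c0) // lef_pV2.
by apply: dist_max_le; apply: dist_div => //;
  rewrite ?ge_min ?lexx ?orbT // prod_normE le_max;
  apply/orP; [left|right]; rewrite le_eqVlt; apply/orP; left; apply/eqP;
  congr (`|_|); rewrite /=; ring.
Qed.

Lemma fstar_half (R : realType) (M : Type) (f : M -> R * R) (b : R) (x : M) :
  fstar f (2^-1, b) x = Num.max ((f x).1 - b) ((f x).2 + b).
Proof.
have e : 1 - 2^-1 = 2^-1 :> R by lra.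
by rewrite /fstar e minxx maxr_pMr ?invr_ge0 // !mulrA !(mulrC 2^-1)
           !mulfK ?invr_eq0.
Qed.

(* For b small (resp. large) the maximum is reached by the first (resp. second)
   component in both f^*_(1/2, b) and g^*_(1/2, b), so b cancels out. *)
Lemma fstar_half_dist_attained (R : realType) (M : Type) (f g : M -> R * R)
    (x : M) :
  exists b, `|fstar f (2^-1, b) x - fstar g (2^-1, b) x| = `|f x - g x|.
Proof.
(* Such a [b] is nonnegative and dominates both gaps between components, so shifting by [b] or by
   [- b] fixes which component is the larger, for [f] and [g] at once. *)
have [b fb gb] : exists2 b,
    `|(f x).1 - (f x).2| <= b & `|(g x).1 - (g x).2| <= b.
  exists (`|(f x).1 - (f x).2| + `|(g x).1 - (g x).2|).
    by rewrite lerDl.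
  by rewrite lerDr.
move: fb gb; rewrite !ler_norml => /andP[fb1 fb2] /andP[gb1 gb2].
(* The sign of the shift is chosen to select the coordinate of [f x - g x] that realizes its
   norm. *)
rewrite prod_normE; case: (leP `|(f x - g x).1|) => _.
  exists b; rewrite !fstar_half !max_r; [|lra|lra].
  by congr `|_|; rewrite /=; ring.
exists (- b); rewrite !fstar_half !max_l; [|lra|lra].
by congr `|_|; rewrite /=; ring.
Qed.

Theorem proposition2p3 (R : realType) (M : topologicalType)
    (M_nonempty : [set: M] !=set0)
    (M_triangulable : finitely_triangulable R M)
    (f g : M -> R * R) (f_cont : continuous f) (g_cont : continuous g) :
  [/\ (exists x : M, supnorm (fun y => f y - g y) = `|f x - g x|%:E),
      supnorm (fun y => f y - g y) =
        ereal_sup [set supnorm (fun y => fstar f ab y - fstar g ab y) |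
                   ab in [set` `]0, 1[] `*` [set: R]]
    & ereal_sup [set supnorm (fun y => fstar f ab y - fstar g ab y) |
                 ab in [set` `]0, 1[] `*` [set: R]] =
        ereal_sup [set supnorm (fun y => fstar f (2^-1, b) y
                                         - fstar g (2^-1, b) y) |
                   b in [set: R]]].
Proof.
have cM := finitely_triangulable_compact R M M_triangulable.
have cfg : continuous (fun y => f y - g y).
  by move=> y; apply: cvgB; [exact: f_cont|exact: g_cont].
set S1 := ereal_sup [set supnorm _ | ab in _ `*` _].
set S2 := ereal_sup [set supnorm _ | b in _].
(* Both equalities follow from a cycle of inequalities: the norm of [f - g] bounds [S1], which
   bounds [S2], which bounds that norm. *)
have S1_le : (S1 <= supnorm (fun y => f y - g y)%R)%E.
  apply: ge_ereal_sup => _ [[a b] [/= ab _] <-].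
  apply: ge_ereal_sup => _ [y _ <-].
  apply: (le_trans (y := (`|f y - g y|%R)%:E)).
    by rewrite lee_fin fstar_dist_le //; case: ab; rewrite in_itv.
  by apply: ereal_sup_ubound; exists y.
have S2_le : (S2 <= S1)%E.
  apply: ge_ereal_sup => _ [b _ <-]; apply: ereal_sup_ubound.
  by exists (2^-1, b) => //; split => //=; rewrite in_itv /=; lra.
have le_S2 : (supnorm (fun y => f y - g y)%R <= S2)%E.
  apply: ge_ereal_sup => _ [y _ <-].
  have [b <-] := fstar_half_dist_attained R M f g y.
  apply: (@le_trans _ _ (supnorm (fun y => fstar f (2^-1, b) y
                                           - fstar g (2^-1, b) y)%R)).
    by apply: ereal_sup_ubound; exists y.
  by apply: ereal_sup_ubound; exists b.
split; first exact: compact_supnorm_attained.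
  by apply/eqP; rewrite eq_le S1_le (le_trans le_S2).
by apply/eqP; rewrite eq_le S2_le (le_trans S1_le).
Qed.
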